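(* Let $V\in C^2(\mathbb{T}^d)$ with $\max_{\mathbb{T}^d}V=0$, let $u:\mathbb{T}^d\to\mathbb{R}$ be a semiconcave viscosity solution of $\frac12|Du(x)|^2+V(x)=0$ on $\mathbb{T}^d$, and let $x\in\mathbb{T}^d$ be such that $\sigma_u(x)=\infty$. Let $M(V)=\mathrm{argmax}_{\mathbb{T}^d}V$. The following properties are equivalent: (a) for any $\mu\in\mathcal{X}_u(x)$, $\int_{\mathbb{T}^d}V(y)\,d\mu(y)=0$; (b) for any $\varepsilon>0$, $$\lim_{T\to\infty}\frac1T\,\mathcal{L}^1\Big(\big\{t\in[0,T]:d_{M(V)}\big(\mathbf{x}_u(t,x)\big)\ge\varepsilon\big\}\Big)=0.$$
   Context: $\mathbb{T}^d=\mathbb{R}^d/\mathbb{Z}^d$ is the flat torus; functions on $\mathbb{T}^d$ are identified with their $\mathbb{Z}^d$-periodic extensions to $\mathbb{R}^d$. A continuous $u:\mathbb{T}^d\to\mathbb{R}$ is semiconcave if there is $C>0$ with $\lambda u(x)+(1-\lambda)u(y)-u(\lambda x+(1-\lambda)y)\le \frac C2\lambda(1-\lambda)|x-y|^2$ for all $x,y$ and $\lambda\in[0,1]$. The superdifferential is $D^+u(x)=\{p\in\mathbb{R}^d:\limsup_{y\to x}\frac{u(y)-u(x)-\langle p,y-x\rangle}{|y-x|}\le0\}$ and the subdifferential is $D^-u(x)=\{p\in\mathbb{R}^d:\liminf_{y\to x}\frac{u(y)-u(x)-\langle p,y-x\rangle}{|y-x|}\ge0\}$. $u$ is a viscosity solution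 of $\frac12|Du|^2+V=0$ if $\frac12|p|^2+V(x)\le0$ for all $x$ and $p\in D^+u(x)$, and $\frac12|p|^2+V(x)\ge0$ for all $x$ and $p\in D^-u(x)$. $\mathrm{Sing}(u)$ is the set of points where $u$ is not differentiable, $\mathrm{Crit}(u)=\{x:0\in D^+u(x)\}$, $\mathrm{Crit}^*(u)=\mathrm{Crit}(u)\setminus\mathrm{Sing}(u)$; it is known that $\mathrm{Crit}^*(u)=\mathrm{argmax}_{\mathbb{T}^d}V$. The generalized gradient flow $\mathbf{x}_u(\cdot,x):[0,\infty)\to\mathbb{T}^d$ is the unique locally Lipschitz solution of $\dot{\mathbf{x}}(t)\in D^+u(\mathbf{x}(t))$ for a.e. $t\ge0$, $\mathbf{x}(0)=x$. The critical time is $\sigma_u(x)=\inf\{t\ge0:\mathbf{x}_u(t,x)\in\mathrm{Crit}(u)\}\in[0,\infty]$ (with $\inf\varnothing=\infty$). For $T>0$, $\mu^T_x$ is the probability measure on $\mathbb{T}^d$ with $\int f\,d\mu^T_x=\frac1T\int_0^Tf(\mathbf{x}_u(t,x))\,dt$ for all $f\in C(\mathbb{T}^d)$. $\mathcal{X}_u(x)$ is the set of occupational measures from $x$: all probability measures $\mu$ on $\mathbb{T}^d$ for which there is a sequence $T_k\uparrow\infty$ with $\mu^{T_k}_x\rightharpoonup\mu$ (i.e. $\int f\,d\mu_x^{T_k}\to\int f\,d\mu$ for all $f\in C(\mathbb{T}^d)$). $d_S(y)$ is the (flat, Euclidean) distance of $y$ from the closed set $S$; $\mathcal{L}^1$ is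 one-dimensional Lebesgue measure. *)

(* Defs.v *)
(* MathComp-Analysis, over an arbitrary realType R. *)
From HB Require Import structures.
From mathcomp Require Import all_boot all_order all_algebra.
From mathcomp Require Import all_classical all_reals all_analysis.

Set Implicit Arguments.
Unset Strict Implicit.
Unset Printing Implicit Defensive.

Import Order.TTheory GRing.Theory Num.Theory.
Import numFieldNormedType.Exports.

Local Open Scope classical_set_scope.
Local Open Scope ring_scope.
Local Open Scope quotient_scope.

Section euclidean.
Context {R : realType} {d : nat}.
Implicit Types (x y p a : 'rV[R]_d) (v : 'rV[R]_d -> R).

Definition dotv x y : R := \sum_i x 0 i * y 0 i.

(* The library norm on 'rV[R]_d is the sup norm: it induces the same topology
   and the same Lipschitz functions, but every formula below that mentions
   |x| uses this Euclidean norm. *)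
Definition enorm x : R := Num.sqrt (dotv x x).

Definition diff_quot v a p y : R := (v y - v a - dotv p (y - a)) / enorm (y - a).

(* [a^'] is the punctured neighbourhood filter: y --> a with y != a. *)
Definition superdiff v a : set 'rV[R]_d :=
  [set p | (limf_esup (fun y => (diff_quot v a p y)%:E) a^' <= 0)%E].

Definition subdiff v a : set 'rV[R]_d :=
  [set p | (0 <= limf_einf (fun y => (diff_quot v a p y)%:E) a^')%E].

Fixpoint Ck (k : nat) v : Prop :=
  continuous v /\
  if k is k'.+1 then
    forall i : 'I_d, (forall a, derivable v a 'e_i) /\ Ck k' ('D_('e_i) v)
  else True.

End euclidean.

Section torus_type.
Variables (R : realType) (d : nat).

Definition same_class : rel 'rV[R]_d := fun x y => (x - y) \is a mxOver Num.int.

Lemma same_class_refl : reflexive same_class.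
Proof. by move=> x; rewrite /same_class subrr mxOver0 ?rpred0. Qed.

Lemma same_class_sym : symmetric same_class.
Proof.
suff sym x y : same_class x y -> same_class y x.
  by move=> x y; apply/idP/idP; exact: sym.
move=> /mxOverP xy; apply/mxOverP => i j.
by have := xy i j; rewrite !mxE -rpredN opprB.
Qed.

Lemma same_class_trans : transitive same_class.
Proof.
move=> y x z /mxOverP xy /mxOverP yz; apply/mxOverP => i j.
have := rpredD (xy i j) (yz i j); rewrite !mxE addrA subrK; exact.
Qed.

Canonical same_class_equiv :=
  EquivRel same_class same_class_refl same_class_sym same_class_trans.

Definition torus := quotient_topology {eq_quot same_class}.

HB.instance Definition _ := Quotient.on torus.
HB.instance Definition _ := PointedTopological.on torus.

End torus_type.

Notation borel_torus R d := (g_sigma_algebraType (@open (torus R d))).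

Section torus_functions.
Context {R : realType} {d : nat}.
Local Notation T := (torus R d).
Implicit Types (u V : T -> R) (x y : T) (S : set T).

Definition perlift u : 'rV[R]_d -> R := u \o \pi_T.

Definition torusC2 V : Prop := Ck 2 (perlift V).

Definition semiconcave u : Prop :=
  continuous u /\
  exists2 C : R, 0 < C &
    forall (a b : 'rV[R]_d) (l : R), 0 <= l <= 1 ->
      l * perlift u a + (1 - l) * perlift u b - perlift u (l *: a + (1 - l) *: b)
        <= C / 2 * l * (1 - l) * enorm (a - b) ^+ 2.

(* [perlift u] is periodic, so the choice of the representative is irrelevant. *)
Definition Dplus u x : set 'rV[R]_d := superdiff (perlift u) (repr x).
Definition Dminus u x : set 'rV[R]_d := subdiff (perlift u) (repr x).

Definition viscosity_solution V u : Prop :=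
  (forall x p, Dplus u x p -> 2^-1 * enorm p ^+ 2 + V x <= 0) /\
  (forall x p, Dminus u x p -> 0 <= 2^-1 * enorm p ^+ 2 + V x).

Definition is_max V (m : R) : Prop :=
  (exists x, V x = m) /\ forall x, V x <= m.

Definition argmax V : set T := [set x | forall y, V y <= V x].

Definition Crit u : set T := [set x | Dplus u x 0].

Definition tdist x y : R :=
  inf [set r | exists a b : 'rV[R]_d,
                 [/\ \pi_T a = x, \pi_T b = y & r = enorm (a - b)]].

Definition dist_to S x : R := inf [set tdist x y | y in S].

End torus_functions.

Section gradient_flow.
Context {R : realType} {d : nat}.
Local Notation T := (torus R d).
Implicit Types (u : T -> R) (x : T) (g : R -> T).
Local Notation leb := (@lebesgue_measure R).

Definition locally_lipschitz_ray (X : R -> 'rV[R]_d) : Prop :=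
  forall t : R, 0 <= t ->
    exists2 U, nbhs t U & [lipschitz X s | s in U `&` `[0, +oo[].

(* Velocities are computed on a lift X of the curve to R^d.  Curves are
   functions on R of which only the values at t >= 0 matter. *)
Definition gradient_flow_from u x g : Prop :=
  exists X : R -> 'rV[R]_d,
    [/\ forall t : R, 0 <= t -> g t = \pi_T (X t),
        locally_lipschitz_ray X,
        {ae leb, forall t : R, 0 <= t ->
                   derivable X t 1 /\ Dplus u (g t) ('D_1 X t)}
      & g 0 = x].

Definition critical_time u g : \bar R :=
  ereal_inf [set t%:E | t in [set t | 0 <= t /\ Crit u (g t)]].

Definition time_average g (tau : R) (mu : probability (borel_torus R d) R) :=
  forall f : T -> R, continuous f ->
    \int[mu]_y f y = tau^-1 * \int[leb]_(t in `[0, tau]) f (g t).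

Definition occupational g : set (probability (borel_torus R d) R) :=
  [set mu : probability (borel_torus R d) R |
    exists (tau : R^nat) (nu : nat -> probability (borel_torus R d) R),
    [/\ nondecreasing_seq tau /\ tau @ \oo --> +oo,
        forall k, 0 < tau k,
        forall k, time_average g (tau k) (nu k)
      & forall f : T -> R, continuous f ->
          (\int[nu k]_y f y) @[k --> \oo] --> \int[mu]_y f y]].

End gradient_flow.

(* Main.v *)
Require Import Defs.
From HB Require Import structures.
From mathcomp Require Import all_boot all_order all_algebra.
From mathcomp Require Import all_classical all_reals all_analysis.
From mathcomp Require Import measurable_realfun finmap ring lra.
Set Implicit Arguments.
Unset Strict Implicit.
Unset Printing Implicit Defensive.

Import Order.TTheory GRing.Theory Num.Theory.
Import numFieldNormedType.Exports.

(** Let A(tau) be the average of V over the curve up to time tau, let C be the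
    closed set of the points at distance at least eps from argmax V, and let
    q(tau) be the fraction of the time up to tau spent in C.  Both properties
    say that A(tau) tends to 0.

    (b) => (a).  Since V is uniformly continuous and vanishes on argmax V, for
    a small eps it is at least - delta outside C, whence
    - delta - B * q(tau) <= A(tau) <= 0 where B bounds |V|
    ([time_fraction_le_mean]).  So A(tau) tends to 0, and the integral of V
    against an occupational measure is a limit of values A(tau_k).

    (a) => (b).  If A(tau) does not tend to 0, then A(tau) <= - delta for
    arbitrarily large tau; weak compactness of the time averages along those
    tau ([occupational_along]) produces an occupational measure against which
    the integral of V is at most - delta, which (a) excludes.  So A(tau) tends
    to 0.  On the compact set C the function V has a negative maximum - c, and
    the Markov inequality c * q(tau) <= - A(tau) concludes.

    Weak compactness is obtained from two facts.  [riesz_representation]: a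
    positive normalized linear functional on the continuous functions of a
    compact space whose open sets are cozero sets is the integral against a
    Borel probability measure; it is proved by Caratheodory extension, and it
    yields both the measure of a time average and the limit measure.
    [time_mean_limit]: the time averages converge along every ultrafilter
    finer than tau -> +oo, by boundedness, and their limit L is again such a
    functional.  A sequence tau_k with averages converging to L is chosen so
    that at step k the averages are close to L on a partition of unity of mesh
    1 / (k + 1); uniform continuity extends the convergence to every
    continuous function ([mean_partition_dist]). *)

Local Open Scope classical_set_scope.
Local Open Scope ring_scope.
Local Open Scope quotient_scope.

(** * Continuous real functions and mean functionals *)

Section continuous_real_functions.
Context {R : realType} {X : topologicalType}.
Implicit Types (f g : X -> R).

Lemma continuous_addf {f g} : continuous f -> continuous g ->
  continuous (fun x => f x + g x).
Proof. by move=> cf cg x; apply: cvgD; [exact: cf|exact: cg]. Qed.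

Lemma continuous_scalef c {f} : continuous f -> continuous (fun x => c * f x).
Proof. by move=> cf x; apply: cvgMr; exact: cf. Qed.

Lemma continuous_subf {f g} : continuous f -> continuous g ->
  continuous (fun x => f x - g x).
Proof. by move=> cf cg x; apply: cvgB; [exact: cf|exact: cg]. Qed.

Lemma continuous_constf (c : R) : continuous (fun _ : X => c).
Proof. by move=> x; exact: cvg_cst. Qed.

Lemma continuous_minf {f g} : continuous f -> continuous g ->
  continuous (fun x => Num.min (f x) (g x)).
Proof. by move=> cf cg x; apply: continuous_min; [exact: cf|exact: cg]. Qed.

Lemma continuous_maxf {f g} : continuous f -> continuous g ->
  continuous (fun x => Num.max (f x) (g x)).
Proof. by move=> cf cg x; apply: continuous_max; [exact: cf|exact: cg]. Qed.

Lemma continuous_sumf (I : Type) (r : seq I) (F : I -> X -> R) :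
  (forall i, continuous (F i)) -> continuous (fun x => \sum_(i <- r) F i x).
Proof.
move=> cF; elim: r => [|i r IH].
  by under eq_fun do rewrite big_nil; exact: continuous_constf.
by under eq_fun do rewrite big_cons; exact: continuous_addf.
Qed.

Lemma continuous_near_dist f :
  (forall x e, 0 < e -> \forall y \near x, `|f x - f y| < e) -> continuous f.
Proof. by move=> h x; apply/cvgrPdist_lt => e e0; exact: h. Qed.

Lemma open_gtf {f} c : continuous f -> open [set x | c < f x].
Proof.
by move=> /continuousP cf; exact: (cf [set y | c < y] (@open_gt _ c)).
Qed.

Lemma open_ltf {f} c : continuous f -> open [set x | f x < c].
Proof.
by move=> /continuousP cf; exact: (cf [set y | y < c] (@open_lt _ c)).
Qed.

Lemma closed_gef {f} c : continuous f -> closed [set x | c <= f x].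
Proof.
move=> cf; rewrite -openC.
rewrite (_ : ~` _ = [set x | f x < c]); first exact: open_ltf.
by apply/seteqP; split=> x /=; rewrite ltNge => /negP.
Qed.

End continuous_real_functions.

(** The positive linear functionals of total mass 1 on the continuous
    functions.  The functional is defined on all functions, but nothing is
    asked of its values at discontinuous ones. *)
Definition mean_functional {R : realType} {X : topologicalType}
    (L : (X -> R) -> R) : Prop :=
  [/\ forall f g, continuous f -> continuous g ->
        L (fun x => f x + g x) = L f + L g,
      forall (c : R) f, continuous (f : X -> R) ->
        L (fun x => c * f x) = c * L f,
      forall f : X -> R, continuous f -> (forall x, 0 <= f x) -> 0 <= L f
    & L (fun=> 1) = 1].

Section mean_functional_theory.
Context {R : realType} {X : topologicalType} {L : (X -> R) -> R}.
Hypothesis meanL : mean_functional L.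
Implicit Types (f g : X -> R).

Lemma meanD {f g} : continuous f -> continuous g ->
  L (fun x => f x + g x) = L f + L g.
Proof. by case: meanL => + _ _ _; exact. Qed.

Lemma meanZ c {f} : continuous f -> L (fun x => c * f x) = c * L f.
Proof. by case: meanL => _ + _ _; exact. Qed.

Lemma mean_ge0 {f} : continuous f -> (forall x, 0 <= f x) -> 0 <= L f.
Proof. by case: meanL => _ _ + _; exact. Qed.

Lemma mean_cst c : L (fun=> c) = c.
Proof.
case: meanL => _ LZ _ L1.
by have := LZ c (fun=> 1) (@continuous_constf _ _ 1); rewrite L1 mulr1.
Qed.

Lemma meanB {f g} : continuous f -> continuous g ->
  L (fun x => f x - g x) = L f - L g.
Proof.
move=> cf cg; rewrite -[in RHS]mulN1r -meanZ// -meanD//.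
  by congr L; apply/funext => x; rewrite mulN1r.
exact: continuous_scalef.
Qed.

Lemma mean_le {f g} : continuous f -> continuous g ->
  (forall x, f x <= g x) -> L f <= L g.
Proof.
move=> cf cg fg; rewrite -subr_ge0 -meanB//; apply: mean_ge0.
  exact: continuous_subf.
by move=> x; rewrite subr_ge0.
Qed.

Lemma mean_sum (I : Type) (r : seq I) (F : I -> X -> R) :
  (forall i, continuous (F i)) ->
  L (fun x => \sum_(i <- r) F i x) = \sum_(i <- r) L (F i).
Proof.
move=> cF; elim: r => [|i r IH].
  by under eq_fun do rewrite big_nil; rewrite mean_cst big_nil.
under eq_fun do rewrite big_cons.
by rewrite meanD// ?IH ?big_cons//; exact: continuous_sumf.
Qed.

Lemma mean_dist_le {f g} e : continuous f -> continuous g ->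
  (forall x, `|f x - g x| <= e) -> `|L f - L g| <= e.
Proof.
move=> cf cg fg.
have cfg : continuous (fun x => f x - g x) by exact: continuous_subf.
rewrite -meanB// ler_norml; apply/andP; split.
  rewrite -[leLHS]mean_cst; apply: mean_le => //.
    exact: continuous_constf.
  by move=> x; have := fg x; rewrite ler_norml => /andP[].
rewrite -[leRHS]mean_cst; apply: mean_le => //.
  exact: continuous_constf.
by move=> x; have := fg x; rewrite ler_norml => /andP[].
Qed.

End mean_functional_theory.

(** * Riesz representation *)

Section inner_content.
Context {R : realType} {X : topologicalType} (L : (X -> R) -> R).
Implicit Types (f g : X -> R) (U W : set X).

Definition below U (f : X -> R) : Prop :=
  [/\ continuous f, forall x, 0 <= f x <= 1 & forall x, ~ U x -> f x = 0].

Definition inner_content U : \bar R := ereal_sup [set (L f)%:E | f in below U].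

(** The outer measure of the Caratheodory construction: the mass that the
    functional gives to an open set from inside, then infima over open
    supersets. *)
Definition outer_content (A : set X) : \bar R :=
  ereal_inf [set inner_content U | U in [set U | open U /\ A `<=` U]].

Lemma below0 U : below U (fun=> 0).
Proof.
by split=> [|x|//]; [exact: continuous_constf|rewrite lexx ler01].
Qed.

Lemma le_inner_content U W : U `<=` W -> (inner_content U <= inner_content W)%E.
Proof.
move=> UW; apply: ereal_sup_le => _ [f [cf f01 f0] <-]; exists f => //.
by split=> // x Wx; apply: f0 => /UW.
Qed.

Lemma inner_content_ub U f : below U f -> ((L f)%:E <= inner_content U)%E.
Proof. by move=> Uf; apply: ereal_sup_ubound; exists f. Qed.

Lemma outer_content_le U A : open U -> A `<=` U ->
  (outer_content A <= inner_content U)%E.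
Proof. by move=> oU AU; apply: ereal_inf_lbound; exists U. Qed.

Lemma outer_content_open U : open U -> outer_content U = inner_content U.
Proof.
move=> oU; apply/eqP; rewrite eq_le outer_content_le//=.
by apply: le_ereal_inf_tmp => _ [W [_ UW] <-]; exact: le_inner_content.
Qed.

(** Truncation replaces a function that vanishes off an open set U, up to a loss
    of e in the mean, by one that vanishes off the closed subset {e <= f} of U. *)
Definition truncate e f : X -> R := fun x => Num.max 0 (f x - e).

Lemma continuous_truncate e f : continuous f -> continuous (truncate e f).
Proof.
move=> cf; apply: continuous_maxf; first exact: continuous_constf.
by apply: continuous_subf => //; exact: continuous_constf.
Qed.

Lemma below_truncate U e f : 0 <= e -> below U f -> below U (truncate e f).
Proof.
move=> e0 [cf f01 f0]; split.
- exact: continuous_truncate.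
- move=> x; rewrite /truncate le_max lexx/= ge_max ler01/=.
  by have /andP[_ ?] := f01 x; lra.
- by move=> x Ux; rewrite /truncate f0// sub0r max_l// oppr_le0.
Qed.

Hypothesis meanL : mean_functional L.

Lemma inner_content_ge0 U : (0 <= inner_content U)%E.
Proof.
by have := inner_content_ub (below0 U); rewrite (mean_cst meanL).
Qed.

Lemma inner_content_le1 U : (inner_content U <= 1)%E.
Proof.
apply: ge_ereal_sup => _ [f [cf f01 f0] <-].
rewrite lee_fin -(mean_cst meanL 1); apply: (mean_le meanL) => //.
  exact: continuous_constf.
by move=> x; have /andP[] := f01 x.
Qed.

Lemma inner_content0 : inner_content set0 = 0%E.
Proof.
apply/eqP; rewrite eq_le inner_content_ge0 andbT.
apply: ge_ereal_sup => _ [f [cf f01 f0] <-].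
rewrite (_ : f = fun=> 0) ?(mean_cst meanL)//.
by apply/funext => x; exact: f0.
Qed.

Lemma inner_contentT : inner_content setT = 1%E.
Proof.
apply/eqP; rewrite eq_le inner_content_le1/=.
rewrite -[X in (X%:E <= _)%E](mean_cst meanL 1); apply: inner_content_ub.
by split=> [|x|x /(_ I)//]; [exact: continuous_constf|rewrite lexx ler01].
Qed.

Lemma outer_content_ge0 A : (0 <= outer_content A)%E.
Proof. by apply: le_ereal_inf_tmp => _ [U _ <-]; exact: inner_content_ge0. Qed.

Lemma outer_content_fin A : outer_content A \is a fin_num.
Proof.
rewrite ge0_fin_numE ?outer_content_ge0//.
apply: le_lt_trans (ltry 1); apply: le_trans (inner_content_le1 setT).
by apply: outer_content_le => //; exact: openT.
Qed.

Lemma mean_truncate e f : continuous f -> L f <= L (truncate e f) + e.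
Proof.
move=> cf; rewrite -[X in _ <= _ + X](mean_cst meanL) -(meanD meanL).
- apply: (mean_le meanL) => //.
    apply: continuous_addf; last exact: continuous_constf.
    exact: continuous_truncate.
  by move=> x; rewrite /truncate -lerBlDr le_max lexx orbT.
- exact: continuous_truncate.
- exact: continuous_constf.
Qed.

(** For an open W that contains A, let f live on W `&` U.  Truncating f confines
    it to a closed set K included in U; then W minus K is open, contains A minus
    U, and any g living on it has support disjoint from that of the truncation,
    so that the sum of the two is still a competitor for W. *)
Lemma outer_content_caratheodory U : open U ->
  forall A, (outer_content (A `&` U) + outer_content (A `&` ~` U)
             <= outer_content A)%E.
Proof.
move=> oU A; set c := outer_content (A `&` ~` U).
have cfin : c \is a fin_num by exact: outer_content_fin.
apply: le_ereal_inf_tmp => _ [W [oW AW] <-].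
apply: (@le_trans _ _ (inner_content (W `&` U) + c)%E).
  by apply: leeD2r; apply: outer_content_le; [exact: openI|exact: setSI].
rewrite -leeBrDr//; apply: ge_ereal_sup => _ [f WUf <-].
rewrite leeBrDr//; apply/lee_addgt0Pr => e e0.
have [cf f01 f0] := WUf.
have [cf' f'01 f'0] := below_truncate (ltW e0) WUf.
have Lf := mean_truncate e cf.
have cKop : open (~` [set x | e <= f x]) by rewrite openC; exact: closed_gef.
suff : ((L (truncate e f))%:E + c <= inner_content W)%E.
  move=> h; apply: (@le_trans _ _ ((L (truncate e f))%:E + c + e%:E)%E).
    by rewrite addeAC; apply: leeD2r; rewrite -EFinD lee_fin.
  exact: leeD2r.
rewrite addeC -leeBrDr//.
apply: (@le_trans _ _ (inner_content (W `&` ~` [set x | e <= f x]))).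
  apply: outer_content_le; first exact: openI.
  move=> x [Ax Ux]; split; first exact: AW.
  by move=> /=; rewrite f0; [lra|case].
apply: ge_ereal_sup => _ [g [cg g01 g0] <-].
rewrite leeBrDr// -EFinD -(meanD meanL)//.
apply: inner_content_ub; split; first exact: continuous_addf.
  (* at each point at most one of the two summands is nonzero *)
  move=> x; have [ef|fe] := leP e (f x).
    by rewrite g0 ?add0r//= => -[_]; exact.
  have := g01 x; rewrite /truncate max_l ?addr0//; lra.
move=> x nWx; rewrite g0 ?f'0 ?addr0//; by case.
Qed.

End inner_content.

Section riesz.
Context {R : realType} {X : ptopologicalType}.
Variable L : (X -> R) -> R.
Hypothesis meanL : mean_functional L.
Hypothesis cptX : compact [set: X].
Hypothesis cozero : forall U : set X, open U ->
  exists2 w : X -> R, continuous w & U = [set x | 0 < w x].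

(** A function f living on the union of the U_n is dominated, up to e, by a
    finite sum of functions living on the U_n: the functions
    min(1, N * w_n), where w_n is positive exactly on U_n, increase to the
    indicator of U_n, and compactness makes one N suffice at all points. *)
Lemma inner_content_bigcup (U : nat -> set X) : (forall n, open (U n)) ->
  (inner_content L (\bigcup_n U n) <= \sum_(n <oo) inner_content L (U n))%E.
Proof.
move=> oU; apply: ge_ereal_sup => _ [f [cf f01 f0] <-].
apply/lee_addgt0Pr => e e0.
have /choice[w wP] : forall n, exists w : X -> R,
    continuous w /\ U n = [set x | 0 < w x].
  by move=> n; have [w cw Uw] := cozero (oU n); exists w.
pose phi (N n : nat) x := Num.max 0 (Num.min 1 (N%:R * w n x)).
have cphi N n : continuous (phi N n).
  apply: continuous_maxf; first exact: continuous_constf.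
  apply: continuous_minf; first exact: continuous_constf.
  by apply: continuous_scalef; case: (wP n).
have belowphi N n : below (U n) (phi N n).
  split=> // x; first by rewrite /phi le_max lexx/= ge_max ler01/= ge_min lexx.
  have [_ ->] := wP n; move=> /negP; rewrite -leNgt => wx.
  by rewrite /phi max_l// ge_min mulr_ge0_le0 ?orbT.
have phi_ge0 N n x : 0 <= phi N n x by rewrite le_max lexx.
have : \forall N \near \oo, [set: X] `<=`
    (fun x => f x <= \sum_(0 <= n < N) phi N n x + e).
  have /compact_near_coveringP := cptX; apply => x _.
  (* where f < e the bound is trivial; elsewhere some w_n is positive, and a
     large N makes the n-th term equal to 1 >= f *)
  have [fe|ef] := ltP (f x) e.
    have fe' : \forall x' \near x, f x' < e.
      exact: (open_nbhs_nbhs (conj (open_ltf e cf) fe)).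
    near=> x' N.
    have fx' : f x' < e by near: x'.
    by apply: ler_wpDl; [exact: sumr_ge0|exact: ltW].
  have [n _ Unx] : (\bigcup_n U n) x.
    by apply: contrapT => /f0 fx0; rewrite fx0 in ef; lra.
  have [cw Uw] := wP n.
  move: Unx; rewrite Uw /= => wx0.
  have wx' : \forall x' \near x, w n x / 2 < w n x'.
    by apply: (open_nbhs_nbhs (conj (open_gtf _ cw) _)) => /=; lra.
  near=> x' N.
  have nN : (n < N)%N by near: N; exact: nbhs_infty_gt.
  have NwN : 2 / w n x <= N%:R by near: N; exact: nbhs_infty_ger.
  have wx2 : w n x / 2 < w n x' by near: x'.
  have phi1 : phi N n x' = 1.
    rewrite /phi min_l ?max_r//.
    rewrite [leLHS](_ : 1 = 2 / w n x * (w n x / 2)); last first.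
      by field; rewrite gt_eqF.
    by apply: ler_pM => //; rewrite ?divr_ge0 ?(ltW wx0) ?(ltW wx2).
  rewrite big_mkord (bigD1 (Ordinal nN))//= phi1.
  have /andP[_ fx1] := f01 x'.
  rewrite -addrA (le_trans fx1)// lerDl addr_ge0 ?(ltW e0)//.
  by rewrite sumr_ge0.
move=> [N _ /(_ N (leqnn N)) fN].
apply: (@le_trans _ _ (\sum_(0 <= n < N) (L (phi N n))%:E + e%:E)%E).
  rewrite sumEFin -EFinD lee_fin -(mean_sum meanL)//.
  rewrite -[X in _ <= _ + X](mean_cst meanL) -(meanD meanL).
  - apply: (mean_le meanL) => //; last by move=> x; exact: fN.
    apply: continuous_addf; last exact: continuous_constf.
    exact: continuous_sumf.
  - exact: continuous_sumf.
  - exact: continuous_constf.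
apply: leeD2r; apply: le_trans (nneseries_lim_ge N _); last first.
  by move=> n _ _; exact: inner_content_ge0.
by apply: lee_sum => n _; exact: inner_content_ub.
Unshelve. all: by end_near. Qed.

Lemma outer_content0 : outer_content L set0 = 0%E.
Proof. by rewrite outer_content_open ?inner_content0//; exact: open0. Qed.

Lemma le_outer_content : {homo outer_content L : A B / A `<=` B >-> (A <= B)%E}.
Proof.
move=> A B AB; apply: le_ereal_inf_tmp => _ [U [oU BU] <-].
by apply: outer_content_le => //; exact: subset_trans BU.
Qed.

Lemma outer_content_sigma_subadditive : sigma_subadditive (outer_content L).
Proof.
move=> A; apply/lee_addgt0Pr => e e0.
apply: le_trans (epsilon_trick _ _ (ltW e0)); last first.
  by move=> n; exact: outer_content_ge0.
have /choice[U UP] : forall n, exists U, [/\ open U, A n `<=` U &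
    (inner_content L U <= outer_content L (A n) + (e / (2 ^ n.+1)%:R)%:E)%E].
  move=> n; have en0 : 0 < e / (2 ^ n.+1)%:R.
    by rewrite divr_gt0// ltr0n expn_gt0.
  have [_ [U [oU AU] <-] lU] :=
    lb_ereal_inf_adherent en0 (outer_content_fin meanL (A n)).
  by exists U; split=> //; exact: ltW.
apply: (@le_trans _ _ (inner_content L (\bigcup_n U n))).
  apply: outer_content_le.
    by apply: bigcup_open => n _; have [] := UP n.
  by move=> x [n _ Ax]; exists n => //; have [_ + _] := UP n; exact.
apply: (le_trans (inner_content_bigcup _)).
  by move=> n; have [] := UP n.
apply: lee_nneseries => n _; last by have [] := UP n.
by move=> _; exact: inner_content_ge0.
Qed.

HB.instance Definition _ := isOuterMeasure.Build R X (outer_content L)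
  outer_content0 (outer_content_ge0 meanL) le_outer_content
  outer_content_sigma_subadditive.

Let Y := g_sigma_algebraType (@open X).

Lemma borel_caratheodory (A : set Y) :
  measurable A -> (outer_content L).-caratheodory A.
Proof.
move=> mA.
suff : [set A | measurable (A : set (caratheodory_type (outer_content L)))] A.
  by [].
apply: (smallest_sub _ _ mA).
  split => /=.
  - exact: measurable0.
  - by move=> B mB; rewrite setTD; exact: measurableC.
  - by move=> F mF; exact: bigcup_measurable.
move=> U oU; apply: le_caratheodory_measurable.
exact: outer_content_caratheodory.
Qed.

Lemma outer_content_sigma_additive :
  semi_sigma_additive (outer_content L : set Y -> \bar R).
Proof.
move=> F mF tF mUF; apply: caratheodory_measure_sigma_additive => //.
  by move=> n; exact: borel_caratheodory.
exact: borel_caratheodory.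
Qed.

HB.instance Definition _ := isMeasure.Build _ Y R
  (outer_content L : set Y -> \bar R)
  outer_content0 (outer_content_ge0 meanL) outer_content_sigma_additive.

Lemma outer_contentT : outer_content L (setT : set Y) = 1%E.
Proof. by rewrite outer_content_open ?inner_contentT//; exact: openT. Qed.

HB.instance Definition _ := Measure_isProbability.Build _ Y R
  (outer_content L : set Y -> \bar R) outer_contentT.

Let mu : probability Y R := (outer_content L : set Y -> \bar R).

Lemma continuous_borel_measurable (f : X -> R) : continuous f ->
  measurable_fun [set: Y] (f : Y -> R).
Proof.
move=> cf; apply: (measurability _ (RGenOInfty.measurableE R)).
move=> _ [_ [a ->] <-]; rewrite setTI; apply: sub_sigma_algebra.
by rewrite set_itvE; exact: (open_gtf a cf).
Qed.

Lemma continuous_borel_integrable (f : X -> R) : continuous f ->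
  mu.-integrable [set: Y] (EFin \o f).
Proof.
move=> cf; apply: measurable_bounded_integrable => //.
- by rewrite [ltLHS]outer_contentT ltry.
- exact: continuous_borel_measurable.
- have /compact_bounded[M [Mreal Mf]] := continuous_compact
    (continuous_subspaceT cf) cptX.
  by exists M; split=> // N MN x _; apply: Mf MN _ _; exists x.
Qed.

(** Peel off from f the layer min(f, h) and iterate on max(0, f - h).  A layer
    has mean at most h times the mass of {0 < f}, whereas h times the mass of
    {h < f} is paid for by the difference of the integrals of f and of
    max(0, f - h): the masses telescope and only the first one remains. *)
Lemma mean_functional_le_layers (h : R) (n : nat) (f : X -> R) : 0 < h ->
  continuous f -> (forall x, 0 <= f x <= h * n%:R) ->
  L f <= h * fine (mu [set x | 0 < f x]) + \int[mu]_x f x.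
Proof.
move=> h0; elim: n f => [|n IH] f cf f0n.
  have -> : f = fun=> 0.
    by apply/funext => x; have := f0n x; rewrite mulr0 => ?; apply/eqP; lra.
  rewrite (mean_cst meanL) addr_ge0 ?Rintegral_ge0//.
  by rewrite mulr_ge0 ?(ltW h0)// fine_ge0.
have cf' : continuous (truncate h f) by exact: continuous_truncate.
have cfh : continuous (fun x => h^-1 * Num.min (f x) h).
  by apply/continuous_scalef/continuous_minf => //; exact: continuous_constf.
have -> : L f = h * L (fun x => h^-1 * Num.min (f x) h) + L (truncate h f).
  rewrite -(meanZ meanL)// -(meanD meanL)//; last exact: continuous_scalef.
  congr L; apply/funext => x; rewrite mulVKf ?gt_eqF// /truncate.
  by case: (leP (f x) h) => fh; [rewrite max_l|rewrite max_r]; lra.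
have Lbelow : L (fun x => h^-1 * Num.min (f x) h) <=
    fine (mu [set x | 0 < f x]).
  rewrite -lee_fin fineK ?outer_content_fin//.
  rewrite [leRHS](outer_content_open L (open_gtf 0 cf)).
  apply: inner_content_ub; split=> // x.
    have /andP[fx0 _] := f0n x.
    have h_ge0 : 0 <= h by exact: ltW.
    rewrite mulr_ge0 ?invr_ge0 ?le_min ?fx0//=.
    by rewrite ler_pdivrMl// mulr1 ge_min lexx orbT.
  move=> /= fx; have /andP[fx0 _] := f0n x.
  have -> : f x = 0 by apply/eqP; move/negP: fx; lra.
  by rewrite min_l ?mulr0// ltW.
have /(IH _ cf') IHf : forall x, 0 <= truncate h f x <= h * n%:R.
  move=> x; have := f0n x; rewrite -natr1 mulrDr mulr1 => fx.
  rewrite /truncate le_max lexx/= ge_max mulr_ge0 ?(ltW h0)//=; lra.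
have pos_truncate : [set x | 0 < truncate h f x] = [set x | h < f x].
  by apply/seteqP; split=> x; rewrite /truncate /= lt_max ltxx/= subr_gt0.
have moh : measurable ([set x | h < f x] : set Y).
  by apply: sub_sigma_algebra; exact: open_gtf.
have layer : h * fine (mu [set x | h < f x]) + \int[mu]_x truncate h f x
    <= \int[mu]_x f x.
  have ind : \int[mu]_x \1_[set x | h < f x] x = fine (mu [set x | h < f x]).
    by rewrite /Rintegral integral_indic// setIT.
  have int1 : mu.-integrable [set: Y] (EFin \o \1_[set x | h < f x]).
    exact: integrable_indic.
  have inth1 : mu.-integrable [set: Y]
      (EFin \o (fun x => h * \1_[set x | h < f x] x)).
    exact: (@integrableZl _ _ _ mu _ measurableT h _ int1).
  rewrite -ind -RintegralZl// -RintegralD//; last 1 first.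
  - exact: continuous_borel_integrable.
  apply: le_Rintegral => //.
  - exact: (integrableD measurableT inth1 (continuous_borel_integrable cf')).
  - exact: continuous_borel_integrable.
  move=> x _; rewrite /truncate indicE; have /andP[fx0 _] := f0n x.
  have [hf|fh] := ltP h (f x).
    by rewrite mem_set//= mulr1n max_r; lra.
  have nhf : ~ h < f x by apply/negP; rewrite -leNgt.
  by rewrite memNset//= mulr0n max_l; lra.
move: Lbelow; rewrite -(ler_pM2l h0) => Lb.
move: IHf; rewrite pos_truncate => IHf.
apply: (le_trans (lerD Lb IHf)); rewrite lerD2l; exact: layer.
Qed.

(** The error term of the layer estimate is at most h, for h arbitrary. *)
Lemma mean_functional_le_integral (f : X -> R) : continuous f ->
  (forall x, 0 <= f x) -> L f <= \int[mu]_x f x.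
Proof.
move=> cf f0; apply/ler_addgt0Pr => h h0.
have [M [Mreal Mf]] := compact_bounded (continuous_compact
    (continuous_subspaceT cf) cptX).
pose n := (Num.truncn ((M + 1) / h)).+1.
have fn x : 0 <= f x <= h * n%:R.
  rewrite f0/=; have /(_ (M + 1)) Mf1 := Mf.
  apply: (@le_trans _ _ (M + 1)).
    by rewrite (le_trans (ler_norm _))// Mf1 ?ltrDl//; exists x.
  by rewrite mulrC -ler_pdivrMr// ltW// truncnS_gt.
apply: (le_trans (mean_functional_le_layers h0 cf fn)).
have mof : measurable ([set x | 0 < f x] : set Y).
  by apply: sub_sigma_algebra; exact: open_gtf.
rewrite addrC lerD2l ler_piMr ?(ltW h0)// -lee_fin fineK ?fin_num_measure//.
exact: probability_le1.
Qed.

(** An inequality between two functionals of total mass 1, valid for all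
    nonnegative functions, is an equality: apply it to M - f and M + f. *)
Theorem riesz_representation :
  exists P : probability Y R, forall f : X -> R, continuous f ->
    \int[P]_x f x = L f.
Proof.
exists mu => f cf.
have [M [Mreal Mf]] := compact_bounded (continuous_compact
    (continuous_subspaceT cf) cptX).
have {}Mf x : `|f x| <= M + 1 by apply: Mf; [rewrite ltrDl|exists x].
have cM : continuous (fun _ : X => M + 1) by exact: continuous_constf.
have intM : \int[mu]_x (M + 1) = M + 1.
  by rewrite Rintegral_cst// [X in fine X]outer_contentT mulr1.
apply/eqP; rewrite eq_le; apply/andP; split.
- have := @mean_functional_le_integral (fun x => M + 1 - f x).
  rewrite (meanB meanL)// (mean_cst meanL) RintegralB//; last 2 first.
  + exact: (continuous_borel_integrable cM).
  + exact: (continuous_borel_integrable cf).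
  rewrite [X in _ <= X - _]intM lerD2l lerN2; apply.
    exact: continuous_subf.
  by move=> x; have := Mf x; rewrite ler_norml => /andP[]; lra.
- have := @mean_functional_le_integral (fun x => M + 1 + f x).
  rewrite (meanD meanL)// (mean_cst meanL) RintegralD//; last 2 first.
  + exact: (continuous_borel_integrable cM).
  + exact: (continuous_borel_integrable cf).
  rewrite [X in _ <= X + _]intM lerD2l; apply.
    exact: continuous_addf.
  by move=> x; have := Mf x; rewrite ler_norml => /andP[]; lra.
Qed.

End riesz.

(** * Metric and compactness of the torus *)

Section euclidean_norm.
Context {R : realType} {d : nat}.
Implicit Types (x y a b : 'rV[R]_d).

Lemma dotvC x y : dotv x y = dotv y x.
Proof. by apply: eq_bigr => i _; rewrite mulrC. Qed.

Lemma dotvDl x y z : dotv (x + y) z = dotv x z + dotv y z.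
Proof. by rewrite -big_split; apply: eq_bigr => i _; rewrite mxE mulrDl. Qed.

Lemma dotvZl c x y : dotv (c *: x) y = c * dotv x y.
Proof. by rewrite mulr_sumr; apply: eq_bigr => i _; rewrite mxE mulrA. Qed.

Lemma dotv_ge0 x : 0 <= dotv x x.
Proof. by apply: sumr_ge0 => i _; rewrite -expr2 sqr_ge0. Qed.

Lemma enorm_ge0 x : 0 <= enorm x.
Proof. exact: sqrtr_ge0. Qed.

Lemma enorm0 : enorm (0 : 'rV[R]_d) = 0.
Proof.
by rewrite /enorm /dotv big1 ?sqrtr0// => i _; rewrite mxE mul0r.
Qed.

Lemma enorm_sub_sym x y : enorm (x - y) = enorm (y - x).
Proof.
by congr Num.sqrt; apply: eq_bigr => i _; rewrite !mxE; ring.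
Qed.

Lemma coord_le_enorm x i : `|x 0 i| <= enorm x.
Proof.
rewrite -sqrtr_sqr; apply: ler_wsqrtr; rewrite /dotv (bigD1 i)//= -expr2 lerDl.
by apply: sumr_ge0 => j _; rewrite -expr2 sqr_ge0.
Qed.

Lemma dotv_eq0 x y : dotv y y = 0 -> dotv x y = 0.
Proof.
move=> y0; apply: big1 => i _; have := coord_le_enorm y i.
by rewrite /enorm y0 sqrtr0 normr_le0 => /eqP ->; rewrite mulr0.
Qed.

(** The discriminant form of the inequality: b * (a * b - c ^+ 2) is the square
    norm of b *: x - c *: y. *)
Lemma dotv_le_enorm x y : dotv x y <= enorm x * enorm y.
Proof.
rewrite (le_trans (ler_norm _))// -sqrtr_sqr -sqrtrM ?dotv_ge0//.
apply: ler_wsqrtr.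
set a := dotv x x; set b := dotv y y; set c := dotv x y.
have [b0|b0] := eqVneq b 0.
  by rewrite /c dotv_eq0// expr0n mulr_ge0 ?dotv_ge0.
have b_gt0 : 0 < b by rewrite lt_neqAle eq_sym b0 dotv_ge0.
have : 0 <= b * (a * b - c ^+ 2).
  have -> : b * (a * b - c ^+ 2) =
      dotv (b *: x + (- c) *: y) (b *: x + (- c) *: y).
    rewrite dotvDl !dotvZl ![dotv _ (_ + _)]dotvC !dotvDl !dotvZl.
    by rewrite [dotv y x]dotvC -/a -/b -/c; ring.
  exact: dotv_ge0.
by rewrite pmulr_rge0// subr_ge0.
Qed.

Lemma ler_enormD x y : enorm (x + y) <= enorm x + enorm y.
Proof.
rewrite -(@ler_pXn2r _ 2) ?nnegrE ?addr_ge0 ?enorm_ge0//.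
rewrite sqrrD !sqr_sqrtr ?dotv_ge0//.
rewrite dotvDl ![dotv _ (x + y)]dotvC !dotvDl [dotv y x]dotvC.
have := dotv_le_enorm x y; lra.
Qed.

Lemma ler_enorm_dist x y z : enorm (x - z) <= enorm (x - y) + enorm (y - z).
Proof. by rewrite -[x - z](subrKA y); exact: ler_enormD. Qed.

Lemma enorm_continuous : continuous (@enorm R d).
Proof.
move=> x; apply: continuous_comp; last exact: sqrt_continuous.
apply: (@continuous_sumf _ _ _ _ (fun i (x : 'rV[R]_d) => x 0 i * x 0 i)) => i.
have ci : continuous (fun x : 'rV[R]_d => x 0 i) by exact: coord_continuous.
by move=> y; exact: cvgM (ci y) (ci y).
Qed.

End euclidean_norm.

Section torus_metric.
Context {R : realType} {d : nat}.
Local Notation T := (torus R d).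
Implicit Types (a b : 'rV[R]_d) (x y : T) (S U : set T).

Lemma torus_piP a b : (\pi_T a = \pi_T b) <-> same_class a b.
Proof.
have ab := eqquotP {eq_quot (@same_class R d)} a b.
by split=> h; [apply: (introT ab); exact: h|apply: (elimT ab); exact: h].
Qed.

(** Translations of R^d act on representatives; this is what lets a distance on
    the torus be measured from any given representative. *)
Lemma torus_shift a a' b : \pi_T a = \pi_T a' ->
  exists2 b', \pi_T b' = \pi_T b & a' - b' = a - b.
Proof.
move=> /torus_piP /mxOverP aa'; exists (b + (a' - a)).
  apply/torus_piP; apply/mxOverP => i j.
  have := aa' i j; rewrite !mxE.
  rewrite -rpredN; move: (a i j) (a' i j) (b i j) => p q r.
  by suff -> : r + (q - p) - r = - (p - q) by []; ring.
by rewrite opprD opprB addrCA [a' + _]addrC subrK addrC.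
Qed.

Lemma tdist_has_lbound x y : has_lbound [set r | exists a b : 'rV[R]_d,
  [/\ \pi_T a = x, \pi_T b = y & r = enorm (a - b)]].
Proof. by exists 0 => _ [a [b [_ _ ->]]]; exact: enorm_ge0. Qed.

Lemma tdist_ge0 x y : 0 <= tdist x y.
Proof.
apply: lb_le_inf; last by move=> _ [a [b [_ _ ->]]]; exact: enorm_ge0.
by exists (enorm (repr x - repr y)), (repr x), (repr y); rewrite !reprK.
Qed.

Lemma tdist_le_enorm a b : tdist (\pi_T a) (\pi_T b) <= enorm (a - b).
Proof. by apply: ge_inf; [exact: tdist_has_lbound|exists a, b]. Qed.

Lemma tdist_lt x y e : tdist x y < e ->
  exists a b, [/\ \pi_T a = x, \pi_T b = y & enorm (a - b) < e].
Proof.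
move=> xye; have h : has_inf [set r | exists a b : 'rV[R]_d,
    [/\ \pi_T a = x, \pi_T b = y & r = enorm (a - b)]].
  split; last exact: tdist_has_lbound.
  by exists (enorm (repr x - repr y)), (repr x), (repr y); rewrite !reprK.
have e0 : 0 < e - tdist x y by rewrite subr_gt0.
have [_ [a [b [ax yb ->]]]] := inf_adherent e0 h.
by rewrite [ltRHS](addrC _ (e - _)) subrK => abe; exists a, b.
Qed.

Lemma dist_to_le_enorm S a b :
  S (\pi_T b) -> dist_to S (\pi_T a) <= enorm (a - b).
Proof.
move=> Sb; apply: le_trans (tdist_le_enorm a b); apply: ge_inf.
  by exists 0 => _ [y _ <-]; exact: tdist_ge0.
by exists (\pi_T b).
Qed.

Lemma dist_to_lt S a e : S !=set0 -> dist_to S (\pi_T a) < e ->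
  exists2 b, S (\pi_T b) & enorm (a - b) < e.
Proof.
move=> [z Sz] Sae.
have h : has_inf [set tdist (\pi_T a) y | y in S].
  split; first by exists (tdist (\pi_T a) z), z.
  by exists 0 => _ [y _ <-]; exact: tdist_ge0.
have e0 : 0 < e - dist_to S (\pi_T a) by rewrite subr_gt0.
have [_ [y Sy <-]] := inf_adherent e0 h.
rewrite [ltRHS](addrC _ (e - _)) subrK => /tdist_lt[a' [b [aa' by_ abe]]].
have [b' bb' ab'] := torus_shift b aa'.
by exists b'; rewrite ?bb' ?by_// ab'.
Qed.

Lemma dist_to_mem S x : S x -> dist_to S x <= 0.
Proof.
by rewrite -[x]reprK -(@enorm0 R d) -(subrr (repr x)); exact: dist_to_le_enorm.
Qed.

Lemma dist_to_lipschitz S a b : S !=set0 ->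
  dist_to S (\pi_T a) <= enorm (a - b) + dist_to S (\pi_T b).
Proof.
move=> S0; apply/ler_addgt0Pr => e e0.
have [|c Sc bc] := @dist_to_lt S b (dist_to S (\pi_T b) + e) S0.
  by rewrite ltrDl.
rewrite (le_trans (dist_to_le_enorm a Sc))// (le_trans (ler_enorm_dist _ b _))//.
by rewrite -addrA lerD2l ltW.
Qed.

Lemma near_enorm a e : 0 < e -> \forall b \near a, enorm (b - a) < e.
Proof.
move=> e0; have ca : continuous (fun b => enorm (b - a)).
  move=> b; apply: (@continuous_comp _ _ _ (fun b => b - a)).
    apply: (@continuousB _ _ _ id (cst a)); first exact: cvg_id.
    exact: cst_continuous.
  exact: enorm_continuous.
by apply: (open_nbhs_nbhs (conj (open_ltf e ca) _)) => /=; rewrite subrr enorm0.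
Qed.

Lemma dist_to_continuous S : S !=set0 -> continuous (dist_to S).
Proof.
move=> S0; apply/quotient_continuous.
suff : continuous (fun a : 'rV[R]_d => dist_to S (\pi_T a)) by [].
apply: continuous_near_dist => a e e0; near=> b.
have ab : enorm (b - a) < e by near: b; exact: near_enorm.
rewrite ltr_norml; have := dist_to_lipschitz a b S0.
by have := dist_to_lipschitz b a S0; rewrite (enorm_sub_sym a b) /=; lra.
Unshelve. all: by end_near. Qed.

Lemma torus_nbhs_enorm x U : nbhs x U ->
  exists2 r, 0 < r &
    forall a b, \pi_T a = x -> enorm (a - b) < r -> U (\pi_T b).
Proof.
rewrite -[x]reprK; set a0 := repr x => Ux.
have : nbhs a0 (\pi_T @^-1` U) by exact: (@pi_continuous _ _ a0).
move=> /nbhs_ballP[r /= r0 rU]; exists r => // a b aa0 abr.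
have [b' <- ab'] := torus_shift b aa0.
apply: rU; split=> // i j; rewrite ord1 /ball/=.
rewrite -ab' in abr; have := coord_le_enorm (a0 - b') j; rewrite !mxE.
by move=> /le_lt_trans ->.
Qed.

Lemma torus_compact : compact [set: T].
Proof.
have -> : [set: T] =
    \pi_T @` [set v : 'rV[R]_d | forall i, `[0, 1]%classic (v ord0 i)].
  apply/seteqP; split=> // x _.
  exists (\row_i (repr x 0 i - (Num.floor (repr x 0 i))%:~R)).
    move=> i; rewrite /= mxE in_itv/= subr_ge0 floor_le/=.
    rewrite lerBlDr; have := floorD1_gt (repr x 0 i : R).
    by rewrite intrD => /ltW; lra.
  rewrite -[RHS]reprK; apply/torus_piP; apply/mxOverP => i j; rewrite !mxE ord1.
  by rewrite addrAC subrr add0r rpredN intr_int.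
apply: continuous_compact; last first.
  apply: (@rV_compact R d (fun=> `[0, 1]%classic)) => i.
  exact: segment_compact.
by apply: continuous_subspaceT; exact: pi_continuous.
Qed.

(** The distance to the complement is a function that is positive exactly on a
    proper open subset; the whole space needs a separate witness because an
    infimum over the empty set is 0. *)
Lemma torus_cozero U : open U ->
  exists2 w : T -> R, continuous w & U = [set x | 0 < w x].
Proof.
move=> oU; have [UT|/existsNP UT] := pselect (forall x, U x).
  exists (fun=> 1); first exact: continuous_constf.
  by apply/seteqP; split=> x //= _; exact: ltr01.
have {}UT : ~` U !=set0 by [].
exists (dist_to (~` U)); first exact: dist_to_continuous.
apply/seteqP; split=> x /=; last first.
  by apply: contraPP => /(@dist_to_mem (~` U) x); rewrite leNgt => /negP.
move=> Ux; have [r r0 rU] := torus_nbhs_enorm (open_nbhs_nbhs (conj oU Ux)).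
rewrite (lt_le_trans r0)// leNgt; apply/negP.
rewrite -[x]reprK => /(dist_to_lt UT)[b nUb]; apply/negP; rewrite -leNgt.
by rewrite leNgt; apply/negP => /(rU _ _ (reprK x)).
Qed.

(** The torus carries only its quotient topology, so the modulus of continuity
    is expressed on representatives; it is uniform because the quotient is
    compact. *)
Lemma torus_uniform_continuous (f : T -> R) e : continuous f -> 0 < e ->
  exists2 r, 0 < r &
    forall a b, enorm (a - b) < r -> `|f (\pi_T a) - f (\pi_T b)| < e.
Proof.
move=> cf e0.
have e20 : 0 < e / 2 by rewrite divr_gt0.
(* compactness, in the form: a property of x and r that holds for y near x and
   r small enough, locally at each x, holds for all x with the same r *)
have : \forall r \near 0^'+, [set: T] `<=` (fun x => forall a b,
    \pi_T a = x -> enorm (a - b) < r -> `|f x - f (\pi_T b)| < e).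
  have /compact_near_coveringP := torus_compact; apply => x _.
  have fx : \forall y \near x, `|f x - f y| < e / 2.
    by have /cvgrPdist_lt := cf x; exact.
  have [r r0 rf] := torus_nbhs_enorm fx.
  have x0 : [set x] !=set0 by exists x.
  have cx := dist_to_continuous x0.
  have xr : \forall y \near x, dist_to [set x] y < r / 2.
    apply: (open_nbhs_nbhs (conj (open_ltf _ cx) _)) => /=.
    by rewrite (le_lt_trans (dist_to_mem _))// divr_gt0.
  near=> y s; move=> /= a b ay abs.
  have yr : dist_to [set x] y < r / 2 by near: y.
  have sr : s < r / 2 by near: s; apply: nbhs_right_lt; rewrite divr_gt0.
  have [c /= cx' ac] : exists2 c, [set x] (\pi_T c) & enorm (a - c) < r / 2.
    by apply: dist_to_lt => //; rewrite ay.
  rewrite -ay.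
  have fxb : `|f x - f (\pi_T b)| < e / 2.
    apply: (rf c) => //; rewrite (le_lt_trans (ler_enorm_dist _ a _))//.
    by rewrite (enorm_sub_sym c a); lra.
  have fxy : `|f x - f (\pi_T a)| < e / 2.
    by apply: (rf c) => //; rewrite (enorm_sub_sym c a); lra.
  rewrite (le_lt_trans (ler_distD (f x) _ _))// (distrC _ (f x)); lra.
move=> nr; have [r [r0 rf]] : exists r, 0 < r /\ forall x a b,
    \pi_T a = x -> enorm (a - b) < r -> `|f x - f (\pi_T b)| < e.
  have : \forall r \near 0^'+, 0 < r /\ forall x a b,
      \pi_T a = x -> enorm (a - b) < r -> `|f x - f (\pi_T b)| < e.
    near=> r; split; first by near: r; exact: nbhs_right_gt.
    by move=> x; have : [set: T] x by []; move: x; near: r.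
  by move=> /filter_ex.
by exists r => // a b; exact: rf.
Unshelve. all: by end_near. Qed.

Lemma torus_partition_of_unity e : 0 < e ->
  exists (r : seq T) (phi : T -> T -> R),
  [/\ forall p, continuous (phi p), forall p x, 0 <= phi p x,
      forall x, \sum_(p <- r) phi p x = 1
    & forall p a, 0 < phi p (\pi_T a) ->
        exists2 b, \pi_T b = p & enorm (a - b) < e].
Proof.
move=> e0.
pose psi p x := Num.max 0 (e - dist_to [set p] x).
have pt0 (p : T) : [set p] !=set0 by exists p.
have cdist p := dist_to_continuous (pt0 p).
have cpsi p : continuous (psi p).
  apply: continuous_maxf; first exact: continuous_constf.
  by apply: continuous_subf => //; exact: continuous_constf.
have psi0 p x : 0 <= psi p x by rewrite le_max lexx.
have psi_gt0 p x : (0 < psi p x) = (dist_to [set p] x < e).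
  by rewrite /psi lt_max ltxx/= subr_gt0.
have := torus_compact; rewrite compact_cover => /(_ T setT
  (fun p => [set x | dist_to [set p] x < e])) [].
- by move=> p _; exact: open_ltf.
- move=> x _; exists x => //=.
  by rewrite (le_lt_trans (dist_to_mem _)).
move=> D _ coverD; pose r : seq T := D; pose s x := \sum_(p <- r) psi p x.
have s_gt0 x : 0 < s x.
  have [p /= pD px] :
      cover [set` D] (fun p => [set x | dist_to [set p] x < e]) x.
    exact: coverD.
  rewrite /s (big_rem p pD)/= ltr_wpDr ?psi_gt0//.
  by rewrite big_seq; apply: sumr_ge0.
exists r, (fun p x => psi p x / s x); split.
- have cs : continuous s by exact: continuous_sumf.
  by move=> p x; apply: (cvgM (cpsi p x) (cvgV _ (cs x))); rewrite gt_eqF.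
- by move=> p x; rewrite divr_ge0// ltW.
- by move=> x; rewrite -mulr_suml -/(s x) divff// gt_eqF.
- move=> p a; rewrite pmulr_lgt0 ?invr_gt0// psi_gt0.
  move=> /(dist_to_lt (pt0 p))[b <- ab].
  by exists b.
Qed.

End torus_metric.

(** * Time averages along a continuous curve *)

(** An ultrafilter contains the preimage of a set or of its complement, so that
    a cluster value, which compactness of [-B, B] provides, is a limit. *)
Lemma ultrafilter_bounded_cvg {R : realType} {I : Type} (F : set_system I)
    (m : I -> R) (B : R) :
  UltraFilter F -> (\forall i \near F, `|m i| <= B) ->
  exists l : R, m i @[i --> F] --> l.
Proof.
move=> FU mB.
have PF : ProperFilter F by exact: ultra_proper.
have mFB : (m @ F) `[- B, B]%classic.
  by apply: filterS mB => i; rewrite /= in_itv/= ler_norml.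
have [l [_ lm]] := @segment_compact R (- B) B (m @ F) _ mFB.
exists l => A lA; have [//|nA] := in_ultra_setVsetC (m @^-1` A) FU.
by have [x [/= nAx Ax]] := lm (~` A) A nA lA.
Qed.

Section time_mean.
Context {R : realType} {d : nat}.
Local Notation T := (torus R d).
Local Notation leb := (@lebesgue_measure R).
Variables (g : R -> T) (G : R -> T).
Hypotheses (cG : continuous G) (gG : forall t, 0 <= t -> g t = G t).

(** The values of g at negative times are arbitrary, hence G: a continuous
    function on the whole line that agrees with g at the times that matter. *)
Definition time_mean (tau : R) (f : T -> R) : R :=
  tau^-1 * \int[leb]_(t in `[0, tau]) f (g t).

Definition time_fraction (C : set T) (tau : R) : R :=
  tau^-1 * fine (leb [set t | 0 <= t <= tau /\ C (g t)]).

Lemma time_meanE tau f :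
  time_mean tau f = tau^-1 * \int[leb]_(t in `[0, tau]) f (G t).
Proof.
congr (_ * _); apply: eq_Rintegral => t /set_mem/=.
by rewrite in_itv/= => /andP[t0 _]; rewrite gG.
Qed.

Lemma integrable_along tau (f : T -> R) : continuous f ->
  leb.-integrable `[0, tau] (EFin \o (fun t => f (G t))).
Proof.
move=> cf; apply: (continuous_compact_integrable (@segment_compact R 0 tau)).
apply: continuous_subspaceT => t; apply: continuous_comp; first exact: cG.
exact: cf.
Qed.

Lemma fine_leb_itv tau : 0 <= tau -> fine (leb `[0, tau]) = tau.
Proof.
rewrite le_eqVlt lebesgue_measure_itv/= lte_fin => /predU1P[<-|->].
  by rewrite ltxx.
by rewrite sube0.
Qed.

Lemma time_mean_functional tau : 0 < tau -> mean_functional (time_mean tau).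
Proof.
move=> tau0; split=> [f h cf ch|c f cf|f cf f0|].
- rewrite !time_meanE -mulrDr; congr (_ * _).
  by apply: RintegralD => //; exact: integrable_along.
- rewrite !time_meanE mulrCA; congr (_ * _).
  by apply: RintegralZl => //; exact: integrable_along.
- by rewrite mulr_ge0 ?invr_ge0 ?(ltW tau0)// Rintegral_ge0.
- rewrite /time_mean Rintegral_cst// fine_leb_itv ?(ltW tau0)//.
  by rewrite mul1r mulVf// gt_eqF.
Qed.

Lemma time_average_exists tau : 0 < tau ->
  exists nu : probability (borel_torus R d) R, time_average g tau nu.
Proof.
move=> tau0; have [nu nuE] := riesz_representation (time_mean_functional tau0)
  (@torus_compact R d) (@torus_cozero R d).
by exists nu => f cf; rewrite nuE.
Qed.

Lemma torus_bounded (f : T -> R) : continuous f ->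
  exists2 B, 0 < B & forall x, `|f x| <= B.
Proof.
move=> cf; have [M [Mreal Mf]] := compact_bounded (continuous_compact
  (continuous_subspaceT cf) (@torus_compact R d)).
exists (`|M| + 1); first by rewrite ltr_wpDl.
by move=> x; apply: Mf; [rewrite (le_lt_trans (ler_norm _))// ltrDl|exists x].
Qed.

Lemma time_mean_bounded tau f B : 0 < tau -> continuous f ->
  (forall x, `|f x| <= B) -> `|time_mean tau f| <= B.
Proof.
move=> tau0 cf fB; have mT := time_mean_functional tau0.
rewrite -[X in `|X|]subr0 -(mean_cst mT 0); apply: (mean_dist_le mT) => //.
  exact: continuous_constf.
by move=> x; rewrite subr0.
Qed.

Lemma time_mean_limit (F : set_system R) : UltraFilter F ->
  (\forall tau \near F, 0 < tau) ->
  exists2 L, mean_functional L &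
    forall f, continuous f -> time_mean tau f @[tau --> F] --> L f.
Proof.
move=> FU Fpos.
have cvgm f : continuous f -> exists l : R, time_mean tau f @[tau --> F] --> l.
  move=> cf; have [B B0 fB] := torus_bounded cf.
  apply: (@ultrafilter_bounded_cvg _ _ _ _ B) => //.
  by apply: filterS Fpos => tau tau0; exact: time_mean_bounded.
pose L f := lim (time_mean tau f @[tau --> F]).
have LE f : continuous f -> time_mean tau f @[tau --> F] --> L f.
  by move=> /cvgm[l fl]; rewrite /L (cvg_lim _ fl).
have FP : ProperFilter F by exact: ultra_proper.
exists L => //; split=> [f h cf ch|c f cf|f cf f0|].
- apply: cvg_lim => //; apply: cvg_trans (cvgD (LE f cf) (LE h ch)).
  apply: near_eq_cvg; apply: filterS Fpos => tau tau0 /=.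
  by rewrite (meanD (time_mean_functional tau0)).
- apply: cvg_lim => //; apply: cvg_trans (cvgMr (LE f cf)).
  apply: near_eq_cvg; apply: filterS Fpos => tau tau0 /=.
  by rewrite (meanZ (time_mean_functional tau0)).
- apply: limr_ge; first by apply/cvg_ex; exists (L f); exact: LE.
  apply: filterS Fpos => tau tau0 /=.
  exact: (mean_ge0 (time_mean_functional tau0)).
- apply: cvg_lim => //; apply: cvg_near_cst; apply: filterS Fpos => tau tau0.
  by case: (time_mean_functional tau0).
Qed.

Lemma measurable_visits C tau : closed C ->
  measurable [set t | 0 <= t <= tau /\ C (g t)].
Proof.
move=> clC.
have -> : [set t | 0 <= t <= tau /\ C (g t)] = `[0, tau] `&` G @^-1` C.
  apply/seteqP; split=> t /=; rewrite in_itv/= => -[t0tau].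
    by rewrite gG//; case/andP: t0tau.
  by rewrite -gG//; case/andP: t0tau.
apply: measurableI => //; apply: closed_measurable.
by apply: closed_comp => // t _; exact: cG.
Qed.

Lemma visits_le C tau : 0 <= tau -> closed C ->
  (leb [set t | (0 <= t <= tau)%R /\ C (g t)] <= tau%:E)%E.
Proof.
move=> tau0 clC; apply: (@le_trans _ _ (leb `[0, tau])).
  apply: le_measure; first by apply/mem_set; exact: measurable_visits.
    by apply/mem_set; exact: measurable_itv.
  by move=> t /= [t0 _]; rewrite in_itv.
by rewrite lebesgue_measure_itv/=; case: ifP => _; rewrite ?sube0 ?lee_fin.
Qed.

(** The Markov inequality, in a form that also serves for negative b. *)
Lemma time_fraction_le_mean C tau (f : T -> R) (a b : R) : 0 < tau ->
  closed C -> continuous f -> (forall y, a + b * \1_C y <= f y) ->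
  a + b * time_fraction C tau <= time_mean tau f.
Proof.
move=> tau0 clC cf abf.
set E := [set t | 0 <= t <= tau /\ C (g t)].
have mE : measurable E by exact: measurable_visits.
have leE : (leb E < +oo)%E.
  by rewrite (le_lt_trans (visits_le (ltW tau0) clC))// ltry.
have itau : leb.-integrable `[0, tau] (EFin \o (fun=> a)).
  exact: (@integrable_along tau (fun=> a) (@continuous_constf _ _ a)).
have intE : leb.-integrable `[0, tau] (EFin \o \1_E).
  apply/integrableP; split; first exact/measurable_EFinP/measurable_indic.
  under eq_integral do rewrite /= ger0_norm//.
  rewrite integral_indic//; apply: le_lt_trans leE; apply: le_measure.
  - by apply/mem_set; apply: measurableI.
  - exact/mem_set.
  - by move=> t [].
have indE : \int[leb]_(t in `[0, tau]) \1_E t = fine (leb E).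
  rewrite /Rintegral integral_indic//; congr (fine (leb _)).
  by apply/setIidPl => t [t0 _] /=; rewrite in_itv.
have intbE : leb.-integrable `[0, tau] (EFin \o (fun t => b * \1_E t)).
  exact: (@integrableZl _ _ _ leb _ (measurable_itv _) b _ intE).
have -> : a + b * time_fraction C tau =
    tau^-1 * \int[leb]_(t in `[0, tau]) (a + b * \1_E t).
  rewrite RintegralD// RintegralZl// indE Rintegral_cst//.
  rewrite fine_leb_itv ?(ltW tau0)//.
  by rewrite /time_fraction -/E; field; rewrite gt_eqF.
rewrite time_meanE ler_pM2l ?invr_gt0//; apply: le_Rintegral => //.
- exact: (integrableD _ itau intbE).
- exact: integrable_along.
move=> t /=; rewrite in_itv/= => t0tau; apply: le_trans (abf _).
rewrite lerD2l; have -> // : \1_E t = \1_C (G t) :> R.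
rewrite !indicE; congr (nat_of_bool _)%:R; rewrite -gG; last by case/andP: t0tau.
by apply/idP/idP => /set_mem => [[_ ?]|?]; apply/mem_set.
Qed.

End time_mean.

(** * Weak limits of time averages *)

Section occupational_measures.
Context {R : realType} {d : nat}.
Local Notation T := (torus R d).
Variables (g : R -> T) (G : R -> T).
Hypotheses (cG : continuous G) (gG : forall t, 0 <= t -> g t = G t).

Lemma sum_dist_cvg0 (F : set_system R) (L : (T -> R) -> R) (r : seq T)
    (phi : T -> T -> R) : Filter F ->
  (forall f, continuous f -> time_mean g tau f @[tau --> F] --> L f) ->
  (forall p, continuous (phi p)) ->
  \sum_(p <- r) `|time_mean g tau (phi p) - L (phi p)| @[tau --> F] --> (0 : R).
Proof.
move=> FF FL cphi; elim: r => [|p r IH].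
  by under eq_fun do rewrite big_nil; exact: cvg_cst.
under eq_fun do rewrite big_cons.
have Lp : `|time_mean g tau (phi p) - L (phi p)| @[tau --> F] --> (0 : R).
  have := cvg_norm (cvgB (FL _ (cphi p)) (cvg_cst (L (phi p)))).
  by rewrite subrr normr0; exact.
by have := cvgD Lp IH; rewrite addr0; exact.
Qed.

(** If f oscillates by at most e on the supports of a partition of unity, then f
    is within e of the combination of the phi p with coefficients f p: two mean
    functionals that almost agree on the phi p almost agree on f. *)
Lemma mean_partition_dist (m L : (T -> R) -> R) (r : seq T) (phi : T -> T -> R)
    (f : T -> R) (e B D : R) :
  mean_functional m -> mean_functional L -> continuous f ->
  (forall x, `|f x| <= B) ->
  (forall p, continuous (phi p)) -> (forall p x, 0 <= phi p x) ->
  (forall x, \sum_(p <- r) phi p x = 1) ->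
  (forall p x, 0 < phi p x -> `|f x - f p| <= e) ->
  \sum_(p <- r) `|m (phi p) - L (phi p)| <= D ->
  `|m f - L f| <= e + B * D + e.
Proof.
move=> mm mL cf fB cphi phi0 phi1 phif mLD.
pose h x := \sum_(p <- r) f p * phi p x.
have cfphi p : continuous (fun x => f p * phi p x) by exact: continuous_scalef.
have ch : continuous h by exact: continuous_sumf.
have fh x : `|f x - h x| <= e.
  rewrite -[f x]mulr1 -(phi1 x) mulr_sumr /h -sumrB.
  rewrite (le_trans (ler_norm_sum _ _ _))// -[leRHS]mulr1 -(phi1 x) mulr_sumr.
  apply: ler_sum => p _; rewrite -mulrBl normrM (ger0_norm (phi0 p x)).
  have := phi0 p x; rewrite le_eqVlt => /predU1P[<-|px]; first by rewrite !mulr0.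
  by rewrite ler_pM2r//; exact: phif.
have hm (M : (T -> R) -> R) : mean_functional M ->
    M h = \sum_(p <- r) f p * M (phi p).
  move=> mM; rewrite (mean_sum mM)//.
  by apply: eq_bigr => p _; rewrite (meanZ mM).
have mLh : `|m h - L h| <= B * D.
  have B0 : 0 <= B by exact: le_trans (fB point).
  rewrite !hm// -sumrB (le_trans (ler_norm_sum _ _ _))//.
  rewrite (le_trans _ (ler_wpM2l B0 mLD))// mulr_sumr.
  by apply: ler_sum => p _; rewrite -mulrBr normrM ler_wpM2r.
have -> : m f - L f = (m f - m h) + (m h - L h) + (L h - L f) by ring.
rewrite (le_trans (ler_normD _ _))// lerD//; last first.
  by rewrite distrC; exact: (mean_dist_le mL).
rewrite (le_trans (ler_normD _ _))// lerD//.
exact: (mean_dist_le mm).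
Qed.

(** Weak sequential compactness of the time averages: an occupational measure
    can be extracted along any set P of times that is unbounded above, and a
    bound that the averages satisfy on P passes to its integral. *)
Lemma occupational_along (P : set R) :
  (forall M : R, exists2 tau, M < tau & P tau) ->
  exists2 mu : probability (borel_torus R d) R, occupational g mu &
    forall f c, continuous f -> (forall tau, P tau -> time_mean g tau f <= c) ->
      \int[mu]_y f y <= c.
Proof.
move=> Pfreq.
have PF : ProperFilter (within P (pinfty_nbhs R)).
  split; last exact: within_filter.
  move=> [M [_ MP]]; have [tau Mtau Ptau] := Pfreq M.
  exact: MP Mtau Ptau.
have [F [FU PFF]] := ultraFilterLemma PF.
have FP : ProperFilter F by exact: ultra_proper.
have FyP : F P by apply: PFF; exact: withinT.
have Fy M : F [set tau | M < tau].
  by apply: PFF; exists M; split=> [|t Mt _//]; exact: num_real.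
have [L mL FL] := time_mean_limit cG gG FU (Fy 0).
have [mu muL] := riesz_representation mL (@torus_compact R d) (@torus_cozero R d).
exists mu; last first.
  move=> f c cf fc; rewrite muL// -(cvg_lim _ (FL f cf))//.
  apply: limr_le; first by apply/cvg_ex; exists (L f); exact: FL.
  by apply: filterS FyP => tau; exact: fc.
have inv_gt0 k : 0 < k.+1%:R^-1 :> R by rewrite invr_gt0.
have /choice[part partP] : forall k : nat, exists rphi : seq T * (T -> T -> R),
  [/\ forall p, continuous (rphi.2 p), forall p x, 0 <= rphi.2 p x,
      forall x, \sum_(p <- rphi.1) rphi.2 p x = 1
    & forall p a, 0 < rphi.2 p (\pi_T a) ->
        exists2 b, \pi_T b = p & enorm (a - b) < k.+1%:R^-1].
  move=> k; have [r [phi rphi]] := @torus_partition_of_unity R d _ (inv_gt0 k).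
  by exists (r, phi).
pose err k tau := \sum_(p <- (part k).1)
  `|time_mean g tau ((part k).2 p) - L ((part k).2 p)|.
have /choice[next nextP] : forall kM : nat * R, exists tau,
    [/\ kM.1%:R < tau, kM.2 < tau & err kM.1 tau < kM.1.+1%:R^-1].
  move=> [k M] /=; apply: (@filter_ex _ F).
  have errk : err k tau @[tau --> F] --> (0 : R).
    by apply: sum_dist_cvg0 => // p; case: (partP k).
  have /cvgrPdist_lt/(_ _ (inv_gt0 k)) := errk.
  apply: filter_app; near=> tau; rewrite sub0r normrN => errtau.
  split; [near: tau; exact: Fy|near: tau; exact: Fy|].
  exact: le_lt_trans (ler_norm _) errtau.
(* the recursion makes the sequence of times nondecreasing, as the definition of
   an occupational measure demands *)
pose tau := fix tau k := if k is j.+1 then next (k, tau j) else next (0, 0).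
have tauP k : k%:R < tau k /\ err k (tau k) < k.+1%:R^-1.
  by case: k => [|k] /=; [case: (nextP (0, 0))|case: (nextP (k.+1, tau k))].
have tau_gt0 k : 0 < tau k by rewrite (le_lt_trans (ler0n _ k))//; case: (tauP k).
have /choice[nu nuP] := fun k => time_average_exists cG gG (tau_gt0 k).
exists tau, nu; split => //.
  split.
    apply/nondecreasing_seqP => k /=; apply: ltW.
    by case: (nextP (k.+1, tau k)).
  apply/cvgryPge => A; near=> k.
  apply: (@le_trans _ _ k%:R); first by near: k; exact: nbhs_infty_ger.
  by apply: ltW; case: (tauP k).
move=> f cf; rewrite muL//.
under eq_fun do rewrite (nuP _ _ cf).
have [B B0 fB] := torus_bounded cf.
apply/cvgrPdist_le => e e0.
have e30 : 0 < e / 3 by rewrite divr_gt0.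
have [s s0 sf] := torus_uniform_continuous cf e30.
near=> k.
have ks : k.+1%:R^-1 < s.
  near: k; exact: (near_infty_natSinv_lt (PosNum s0)).
have kB : B * k.+1%:R^-1 <= e / 3.
  rewrite -ler_pdivlMl// ltW//; near: k.
  have eB0 : 0 < B^-1 * (e / 3) by rewrite mulr_gt0 ?invr_gt0.
  exact: (near_infty_natSinv_lt (PosNum eB0)).
have [cphi phi0 phi1 phid] := partP k.
have [_ /ltW errk] := tauP k.
have phif p x : 0 < (part k).2 p x -> `|f x - f p| <= e / 3.
  rewrite -[x]reprK => /phid[b <- ab]; apply/ltW/sf; exact: lt_trans ab ks.
have mtau := time_mean_functional cG gG (tau_gt0 k).
have := mean_partition_dist mtau mL cf fB cphi phi0 phi1 phif errk.
rewrite distrC => /le_trans; apply.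
by apply: le_trans (lerD (lerD (lexx _) kB) (lexx _)) _; lra.
Unshelve. all: by end_near. Qed.

End occupational_measures.

(** * The equivalence *)

(** The extension freezes the curve at its starting point for negative times. *)
Lemma gradient_flow_continuous {R : realType} {d : nat} (u : torus R d -> R)
    (x : torus R d) (g : R -> torus R d) : gradient_flow_from u x g ->
  exists2 G : R -> torus R d, continuous G & forall t, 0 <= t -> g t = G t.
Proof.
move=> [X [gX lipX _ _]].
exists (fun t => \pi_(torus R d) (X (Num.max 0 t))); last first.
  by move=> t t0; rewrite max_r//; exact: gX.
have cX : continuous (fun t : R => X (Num.max 0 t)).
  move=> t; have t0 : 0 <= Num.max 0 t by rewrite le_max lexx.
  have [U Ut lipU] := lipX _ t0.
  have [k [k0 kU]] : exists k, 0 < k /\ forall s, U s -> 0 <= s ->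
      `|X (Num.max 0 t) - X s| <= k * `|Num.max 0 t - s|.
    have : \forall k \near +oo, 0 < k /\ forall s, U s -> 0 <= s ->
        `|X (Num.max 0 t) - X s| <= k * `|Num.max 0 t - s|.
      near=> k; split=> [|s Us s0]; first by near: k; exact: nbhs_pinfty_gt.
      have kU : forall z : R * R, ((U `&` `[0, +oo[) `*` (U `&` `[0, +oo[)) z ->
          `|X z.1 - X z.2| <= k * `|z.1 - z.2| by near: k; exact: lipU.
      apply: (kU (Num.max 0 t, s)); split; split=> //=; rewrite ?in_itv/= ?andbT//.
      exact: nbhs_singleton.
    by move=> /filter_ex.
  have cmax : (fun s : R => Num.max 0 s) @ t --> Num.max 0 t.
    exact: (continuous_maxf (@continuous_constf _ _ 0) (fun _ => cvg_id)).
  apply/cvgrPdist_lt => e e0; near=> s.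
  have Us : U (Num.max 0 s) by near: s; exact: cmax.
  have se : `|Num.max 0 t - Num.max 0 s| < e / k.
    near: s; move/cvgrPdist_lt : cmax; apply; exact: divr_gt0.
  apply: (le_lt_trans (kU _ Us _)); first by rewrite le_max lexx.
  by rewrite mulrC -ltr_pdivlMr.
by move=> t; apply: continuous_comp; [exact: cX|exact: pi_continuous].
Unshelve. all: by end_near. Qed.

Theorem theorem21 (R : realType) (d : nat) (V u : torus R d -> R)
    (x : torus R d) (xu : R -> torus R d)
    (V_C2 : torusC2 V) (max_V : is_max V 0)
    (u_semiconcave : semiconcave u)
    (u_solution : viscosity_solution V u)
    (xu_flow : gradient_flow_from u x xu)
    (sigma_infty : critical_time u xu = +oo%E) :
  (forall mu, occupational xu mu -> \int[mu]_y V y = 0)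
  <->
  (forall eps : R, 0 < eps ->
     (fun tau : R => (tau^-1)%:E *
        lebesgue_measure [set t : R | (0 <= t <= tau)%R /\
                                      (eps <= dist_to (argmax V) (xu t))%R])%E
       @ +oo --> 0%E).
Proof.
have [G cG gG] := gradient_flow_continuous xu_flow.
have cV : continuous V by apply/quotient_continuous; case: V_C2.
have [[y0 Vy0] V_le0] := max_V.
have argmaxE y : argmax V y <-> V y = 0.
  split=> [My|Vy z]; last by rewrite Vy.
  by apply/eqP; rewrite eq_le V_le0/= -Vy0; exact: My.
have argmax0 : argmax V !=set0 by exists y0; apply/argmaxE.
have cdist := dist_to_continuous argmax0.
pose far eps := [set y | eps <= dist_to (argmax V) y].
have closed_far eps : closed (far eps) by exact: closed_gef.
(* V attains its maximum on the closed set of points far from argmax V *)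
have V_away eps : 0 < eps ->
    exists2 c, 0 < c & forall y, far eps y -> c <= - V y.
  move=> eps0; have [far0|/set0P far0] := eqVneq (far eps) set0.
    by exists 1 => // y; rewrite far0.
  have [|y /set_mem fary Vy] :=
      @compact_EVT_max _ _ V _ far0 _ (continuous_subspaceT cV).
    by apply: subclosed_compact (@torus_compact R d) _.
  exists (- V y); last by move=> z farz; rewrite lerN2 Vy// mem_set.
  rewrite oppr_gt0 lt_neqAle V_le0 andbT; apply/eqP => /argmaxE /dist_to_mem.
  by move=> /(le_trans fary); rewrite leNgt eps0.
have V_near del : 0 < del ->
    exists2 eps, 0 < eps & forall y, ~ far eps y -> - del <= V y.
  move=> del0; have [r r0 rV] := torus_uniform_continuous cV del0.
  exists r => // y /= /negP; rewrite -ltNge -[y]reprK.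
  move=> /(dist_to_lt argmax0)[b /argmaxE Vb ab].
  by have := rV _ _ ab; rewrite Vb subr0 ltr_norml => /andP[/ltW].
have fractionE eps tau : 0 < tau ->
    ((tau^-1)%:E * lebesgue_measure [set t : R | (0 <= t <= tau)%R /\
       (eps <= dist_to (argmax V) (xu t))%R])%E
    = (time_fraction xu (far eps) tau)%:E.
  move=> tau0; rewrite /time_fraction EFinM fineK//.
  rewrite ge0_fin_numE//; apply: le_lt_trans (ltry tau).
  exact: (visits_le cG gG (ltW tau0)).
have fraction_ge0 eps tau : 0 < tau -> 0 <= time_fraction xu (far eps) tau.
  by move=> tau0; rewrite mulr_ge0 ?invr_ge0 ?(ltW tau0)// fine_ge0.
have mean_functional_V tau (tau0 : 0 < tau) := time_mean_functional cG gG tau0.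
split=> [V0 eps eps0|frac0 mu [tau [nu [[_ tauy] tau0 nuE weak]]]].
- have mean0 del : 0 < del -> \forall tau \near +oo, - del < time_mean xu tau V.
    move=> del0; apply: contrapT => nmean.
    have [M|mu /V0 muV muP] := @occupational_along _ _ _ _ cG gG
        [set tau | time_mean xu tau V <= - del].
      apply: contrapT => noM; apply: nmean; exists M.
      split; first exact: num_real.
      move=> tau Mtau; rewrite ltNge; apply/negP => taudel.
      by apply: noM; exists tau.
    have /= := muP V (- del) cV; rewrite muV oppr_ge0 leNgt del0.
    by move=> /(_ (fun _ h => h)).
  have [c c0 farc] := V_away _ eps0.
  have frac_le tau : 0 < tau ->
      time_fraction xu (far eps) tau <= c^-1 * - time_mean xu tau V.
    move=> tau0; rewrite -ler_pdivrMl ?invr_gt0// invrK.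
    have cNV : continuous (fun y => -1 * V y) by exact: continuous_scalef.
    rewrite -mulN1r -(meanZ (mean_functional_V _ tau0))// -[leLHS]add0r.
    apply: (time_fraction_le_mean cG gG) => // y; rewrite add0r mulN1r indicE.
    have [/set_mem/farc|_] := boolP (y \in far eps); first by rewrite mulr1.
    by rewrite mulr0 oppr_ge0.
  apply/fine_cvgP; split.
    near=> tau; have tau0 : 0 < tau by near: tau; exact: nbhs_pinfty_gt.
    by rewrite fractionE.
  apply/cvgrPdist_lt => e e0; near=> tau.
  have tau0 : 0 < tau by near: tau; exact: nbhs_pinfty_gt.
  rewrite /= fractionE//= sub0r normrN ger0_norm ?fraction_ge0//.
  rewrite (le_lt_trans (frac_le _ tau0))// -ltr_pdivlMl ?invr_gt0// invrK ltrNl.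
  by near: tau; apply: mean0; rewrite mulr_gt0.
- have meanV : time_mean xu (tau k) V @[k --> \oo] --> \int[mu]_y V y.
    by have := weak V cV; under eq_fun do rewrite (nuE _ _ cV).
  suff /(cvg_unique _ meanV) :
    time_mean xu (tau k) V @[k --> \oo] --> (0 : R) by exact.
  have [B B0 VB] := torus_bounded cV.
  apply/cvgrPdist_le => e e0.
  have e20 : 0 < e / 2 by rewrite divr_gt0.
  have [eps eps0 Veps] := V_near _ e20.
  have frac_small : \forall k \near \oo,
      time_fraction xu (far eps) (tau k) < B^-1 * (e / 2).
    have /fine_cvgP[_ /cvgrPdist_lt fr] := frac0 _ eps0.
    have /fr frB : 0 < B^-1 * (e / 2) by rewrite mulr_gt0 ?invr_gt0.
    apply: (@filterS _ \oo _ _ _ _ (tauy _ frB)) => k /=.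
    by rewrite fractionE//= sub0r normrN ger0_norm ?fraction_ge0.
  near=> k.
  have mk := mean_functional_V _ (tau0 k).
  have meank_le0 : time_mean xu (tau k) V <= 0.
    rewrite -(mean_cst mk 0); apply: (mean_le mk) => //.
    exact: continuous_constf.
  have := @time_fraction_le_mean _ _ _ _ cG gG (far eps) (tau k) V
    (- (e / 2)) (- B) (tau0 k) (closed_far _) cV.
  have frk : B * time_fraction xu (far eps) (tau k) <= e / 2.
    by rewrite -ler_pdivlMl// ltW//; near: k.
  rewrite sub0r normrN ler0_norm// => lowk; rewrite lerNl.
  apply: le_trans (lowk _); first by rewrite mulNr; lra.
  move=> y; rewrite indicE; have [_|/negP yfar] := boolP (y \in far eps).
    rewrite mulr1; have := VB y; rewrite ler_norml => /andP[]; lra.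
  by rewrite mulr0 addr0; apply: Veps => farB; apply: yfar; exact: mem_set.
Unshelve. all: by end_near. Qed.
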